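(* Let $\Lambda$ be an arbitrary ring. Then $\mathfrak{s}\subseteq\mathfrak{t}$, i.e., the injective torsion functor $\mathfrak{s}$ on right $\Lambda$-modules is a subfunctor of the Bass torsion functor $\mathfrak{t}$: for every right $\Lambda$-module $A$ one has $\mathfrak{s}(A)\subseteq\mathfrak{t}(A)$ as submodules of $A$.
   Context: $\Lambda$ is an arbitrary ring with identity and $\iota:\Lambda\to I$ is the injective envelope of $\Lambda$ viewed as a left $\Lambda$-module. For a right $\Lambda$-module $A$, the injective torsion is $\mathfrak{s}(A):=\ker\big(1\otimes\iota: A\otimes_\Lambda\Lambda\to A\otimes_\Lambda I\big)$, identified with a submodule of $A$ via $A\otimes_\Lambda\Lambda\cong A$; this is a subfunctor of the identity functor on right $\Lambda$-modules. The Bass torsion of $A$ is $\mathfrak{t}(A):=\ker(e_A:A\to A^{**})$, where $A^*:=\mathrm{Hom}_\Lambda(A,\Lambda)$ and $e_A$ is the canonical evaluation map; it is also a subfunctor of the identity functor. *)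

(* Defs.v *)
From HB Require Import structures.
From mathcomp Require Import all_boot all_order all_algebra.
From mathcomp Require Import ring_quotient generic_quotient.
From mathcomp Require Import boolp.
From mathcomp Require Import freeg.

Set Implicit Arguments.
Unset Strict Implicit.
Unset Printing Implicit Defensive.

Import GRing.Theory.
Local Open Scope ring_scope.
Local Open Scope quotient_scope.

(* Rings are [pzRingType]: associative, with identity, not necessarily
   commutative, possibly zero.  A left R-module is an [lmodType R]; a right
   R-module is a left module over the converse ring, that is an
   [lmodType R^c], and a.r is written (r : R^c) *: a.  The ring R is the left
   module R^o, and the right module R^c^o. *)

(* The tensor product of a right module A and a left module M: the free abelian
   group on A * M modulo the subgroup generated by the elements
   (a + b, m) - (a, m) - (b, m), (a, m + n) - (a, m) - (a, n) and
   (a.r, m) - (a, r.m). *)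
Section TensorProduct.
Variables (R : pzRingType) (A : lmodType R^c) (M : lmodType R).

Definition pre_tensor : zmodType := {freeg (A * M)%type / int}.

Definition pure (a : A) (m : M) : pre_tensor := << (a, m) >>.

Variant tensor_relator : pre_tensor -> Prop :=
| TensorAddl a b m : tensor_relator (pure (a + b) m - pure a m - pure b m)
| TensorAddr a m n : tensor_relator (pure a (m + n) - pure a m - pure a n)
| TensorBal a (r : R) m :
    tensor_relator (pure ((r : R^c) *: a) m - pure a (r *: m)).

Definition tensor_null : {pred pre_tensor} :=
  [pred x | `[< forall S : {pred pre_tensor}, zmod_closed S ->
                  (forall y, tensor_relator y -> y \in S) -> x \in S >]].

Lemma tensor_nullP x : reflect
  (forall S : {pred pre_tensor}, zmod_closed S ->
     (forall y, tensor_relator y -> y \in S) -> x \in S) (x \in tensor_null).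
Proof. exact: asboolP. Qed.

Lemma tensor_null_closed : zmod_closed tensor_null.
Proof.
split; first by apply/tensor_nullP => S [].
move=> x y /tensor_nullP xS /tensor_nullP yS; apply/tensor_nullP => S cS rS.
by case: (cS) => _; apply; [apply: xS | apply: yS].
Qed.

HB.instance Definition _ :=
  GRing.isZmodClosed.Build pre_tensor tensor_null tensor_null_closed.

Definition tensor : Type := Quotient.quot tensor_null.

HB.instance Definition _ := GRing.Zmodule.on tensor.

Definition tensor_pi (x : pre_tensor) : tensor :=
  \pi_(Quotient.quot tensor_null) x.

Lemma tensor_pi_is_zmod_morphism : zmod_morphism tensor_pi.
Proof. by move=> x y; rewrite /tensor_pi raddfB. Qed.

HB.instance Definition _ :=
  GRing.isZmodMorphism.Build pre_tensor tensor tensor_pi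
    tensor_pi_is_zmod_morphism.

Lemma tensor_pi_eq x y : tensor_pi x = tensor_pi y <-> x - y \in tensor_null.
Proof. by rewrite Quotient.idealrBE; split=> /eqP. Qed.

Lemma tensor_pi_surj (u : tensor) : exists x, u = tensor_pi x.
Proof. by exists (repr (u : Quotient.quot tensor_null)); rewrite /tensor_pi reprK. Qed.

Definition tens (a : A) (m : M) : tensor := tensor_pi (pure a m).

End TensorProduct.

Definition balanced (R : pzRingType) (A : lmodType R^c) (M : lmodType R)
    (V : zmodType) (b : A -> M -> V) : Prop :=
  [/\ forall x y m, b (x + y) m = b x m + b y m,
      forall x m n, b x (m + n) = b x m + b x n
    & forall x (r : R) m, b ((r : R^c) *: x) m = b x (r *: m)].

Section TensorLift.
Variables (R : pzRingType) (A : lmodType R^c) (M : lmodType R) (V : zmodType).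

Lemma tens_balanced : balanced (@tens R A M).
Proof.
have rel0 y : tensor_relator y -> tensor_pi y = 0 :> tensor A M.
  move=> ry; rewrite -(raddf0 (@tensor_pi R A M)); apply/tensor_pi_eq.
  by rewrite subr0; apply/tensor_nullP => S _; apply.
split=> [x y m|x m n|x r m]; apply/eqP; rewrite -subr_eq0 ?opprD ?addrA.
- by rewrite -(rel0 _ (TensorAddl x y m)) !raddfB.
- by rewrite -(rel0 _ (TensorAddr x m n)) !raddfB.
- by rewrite -(rel0 _ (TensorBal x r m)) !raddfB.
Qed.

Variables (b : A -> M -> V) (hb : balanced b).

Definition pre_lift (x : pre_tensor A M) : V :=
  fglift (fun p : A * M => b p.1 p.2 : zmodule V) x.

Lemma pre_lift_is_zmod_morphism : zmod_morphism pre_lift.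
Proof. by move=> x y; rewrite /pre_lift lift_is_additive. Qed.

HB.instance Definition _ :=
  GRing.isZmodMorphism.Build (pre_tensor A M) V pre_lift
    pre_lift_is_zmod_morphism.

Lemma pre_liftU a m : pre_lift (pure a m) = b a m.
Proof. by rewrite /pre_lift liftU scale1r. Qed.

Lemma pre_lift_null x : x \in @tensor_null R A M -> pre_lift x = 0.
Proof.
have [hl hr hs] := hb.
move=> /tensor_nullP/(_ [pred y | pre_lift y == 0]) H; apply/eqP/H => {x H}.
  split=> [|x y]; rewrite !inE; first by rewrite raddf0.
  by rewrite raddfB /= => /eqP-> /eqP->; rewrite subrr.
move=> _ [] *; rewrite inE !raddfB /= !pre_liftU ?hl ?hr ?hs; apply/eqP.
- by rewrite addrAC addrK subrr.
- by rewrite addrAC addrK subrr.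
- by rewrite subrr.
Qed.

Definition tensor_lift of balanced b := fun u : tensor A M =>
  pre_lift (repr (u : Quotient.quot (@tensor_null R A M))).

Lemma tensor_lift_pi x : tensor_lift hb (tensor_pi x) = pre_lift x.
Proof.
apply/eqP; rewrite -subr_eq0 -raddfB; apply/eqP/pre_lift_null/tensor_pi_eq.
by rewrite /tensor_pi reprK.
Qed.

Lemma tensor_lift_is_zmod_morphism : zmod_morphism (tensor_lift hb).
Proof.
move=> u v; have [x ->] := tensor_pi_surj u; have [y ->] := tensor_pi_surj v.
by rewrite -raddfB !tensor_lift_pi raddfB.
Qed.

HB.instance Definition _ :=
  GRing.isZmodMorphism.Build (tensor A M) V (tensor_lift hb)
    tensor_lift_is_zmod_morphism.

Lemma tensor_liftE a m : tensor_lift hb (tens a m) = b a m.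
Proof. by rewrite tensor_lift_pi pre_liftU. Qed.

End TensorLift.

Lemma tensor_ext (R : pzRingType) (A : lmodType R^c) (M : lmodType R)
    (V : zmodType) (f g : {additive tensor A M -> V}) :
  (forall a m, f (tens a m) = g (tens a m)) -> f =1 g.
Proof.
move=> fg u; have [x ->] := tensor_pi_surj u.
rewrite -(freeg_sumE x) !raddf_sum /=; apply: eq_bigr => -[a m] _.
have -> k : << k *g (a, m) >> = pure a m *~ k by rewrite /pure freegU_mulz intz.
by rewrite !raddfMz /= -/(tens a m) fg.
Qed.

Section TensorMap.
Variables (R : pzRingType) (A B : lmodType R^c) (M N : lmodType R).
Variables (g : {linear A -> B}) (f : {linear M -> N}).

Lemma tensor_map_balanced : balanced (fun a m => tens (g a) (f m)).
Proof.
have [hl hr hs] := @tens_balanced R B N.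
by split=> *; rewrite ?linearD ?linearZ ?hl ?hr ?hs.
Qed.

Definition tensor_map : {additive tensor A M -> tensor B N} :=
  tensor_lift tensor_map_balanced.

Lemma tensor_mapE a m : tensor_map (tens a m) = tens (g a) (f m).
Proof. exact: tensor_liftE. Qed.

End TensorMap.

Section TensorUnit.
Variables (R : pzRingType) (A : lmodType R^c).

Lemma tensor_unit_balanced :
  balanced (fun (a : A) (r : R^o) => (r : R^c) *: a).
Proof. by split=> *; rewrite ?scalerDr ?scalerDl ?scalerA. Qed.

(* The canonical isomorphism A (x) R -> A, a (x) r |-> a.r, and its inverse. *)
Definition tensor_unit : {additive tensor A R^o -> A} :=
  tensor_lift tensor_unit_balanced.

Definition tensor_unit_inv (a : A) : tensor A R^o := tens a (1 : R^o).

Lemma tensor_unitE a (r : R^o) : tensor_unit (tens a r) = (r : R^c) *: a.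
Proof. exact: tensor_liftE. Qed.

Lemma tensor_unit_invB : zmod_morphism tensor_unit_inv.
Proof.
have [hl _ _] := @tens_balanced R A R^o.
by move=> x y; apply/eqP; rewrite eq_sym subr_eq -hl subrK.
Qed.

HB.instance Definition _ :=
  GRing.isZmodMorphism.Build A (tensor A R^o) tensor_unit_inv tensor_unit_invB.

Lemma tensor_unit_invK : cancel tensor_unit_inv tensor_unit.
Proof. by move=> a; rewrite tensor_unitE scale1r. Qed.

Lemma tensor_unitK : cancel tensor_unit tensor_unit_inv.
Proof.
apply: (@tensor_ext _ _ _ _ (tensor_unit_inv \o tensor_unit) idfun) => a r /=.
have [_ _ hs] := @tens_balanced R A R^o.
by rewrite tensor_unitE /tensor_unit_inv hs -[_ *: _]/(r * 1) mulr1.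
Qed.

End TensorUnit.

Definition injective_module (R : pzRingType) (I : lmodType R) : Prop :=
  forall (M N : lmodType R) (f : {linear M -> N}) (g : {linear M -> I}),
    injective f -> exists h : {linear N -> I}, forall x, h (f x) = g x.

Definition essential_mono (R : pzRingType) (M I : lmodType R)
    (f : {linear M -> I}) : Prop :=
  injective f /\
  forall N : {pred I}, submod_closed N ->
    (forall x, f x \in N -> f x = 0) -> forall y, y \in N -> y = 0.

Definition injective_envelope (R : pzRingType) (M I : lmodType R)
    (f : {linear M -> I}) : Prop :=
  injective_module I /\ essential_mono f.

(* [inj_torsion iota A] is the image of the kernel of
   1 (x) iota : A (x) R -> A (x) I under the isomorphism A (x) R -> A. *)
Definition inj_torsion (R : pzRingType) (I : lmodType R)
    (iota : {linear R^o -> I}) (A : lmodType R^c) : {pred A} :=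
  [pred a | `[< exists2 u : tensor A R^o,
                  tensor_map (idfun : {linear A -> A}) iota u = 0 &
                  tensor_unit A u = a >]].
Arguments inj_torsion {R I} iota A _.

Lemma inj_torsionP (R : pzRingType) (I : lmodType R)
    (iota : {linear R^o -> I}) (A : lmodType R^c) (a : A) :
  reflect (tens a (iota 1) = 0) (a \in inj_torsion iota A).
Proof.
apply: (iffP (asboolP _)) => [[u u0 <-]|a0].
  by rewrite -[u]tensor_unitK tensor_mapE in u0.
by exists (tensor_unit_inv a); rewrite ?tensor_mapE ?tensor_unit_invK.
Qed.

Lemma inj_torsion_functor (R : pzRingType) (I : lmodType R)
    (iota : {linear R^o -> I}) (A B : lmodType R^c) (g : {linear A -> B}) a :
  a \in inj_torsion iota A -> g a \in inj_torsion iota B.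
Proof.
move=> /inj_torsionP a0; apply/inj_torsionP.
by rewrite -[LHS](tensor_mapE g (idfun : {linear I -> I})) a0 raddf0.
Qed.

Lemma inj_torsion_submod (R : pzRingType) (I : lmodType R)
    (iota : {linear R^o -> I}) (A : lmodType R^c) :
  injective_envelope iota -> submod_closed (inj_torsion iota A).
Proof.
case=> injI [iota_inj _]; have [hl _ hs] := @tens_balanced R A I.
have a0 : tens (0 : A) (iota 1) = 0.
  by apply: (addrI (tens 0 (iota 1))); rewrite -hl !addr0.
split; first exact/inj_torsionP.
move=> r a b /inj_torsionP ta /inj_torsionP tb; apply/inj_torsionP.
pose rho (x : R^o) : I := iota (x * (r : R)).
have rho_lin : linear rho.
  by move=> k x y; rewrite /rho mulrDl -mulrA linearD -linearZ.
pose Rho : {linear R^o -> I} := HB.pack rho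
  (GRing.isLinear.Build _ _ _ _ rho rho_lin).
have [h hE] := injI _ _ _ Rho iota_inj.
rewrite hl tb addr0 hs -linearZ -[_ *: _]/((r : R) * 1) mulr1.
have -> : iota r = h (iota 1) by rewrite hE /= /rho mul1r.
by rewrite -[LHS](tensor_mapE (idfun : {linear A -> A}) h) ta raddf0.
Qed.

Lemma linear_ext (R : pzRingType) (U V : lmodType R) (f g : {linear U -> V}) :
  f =1 g -> f = g.
Proof.
case: f g => [f [[fA] [fZ]]] [g [[gA] [gZ]]] /= /funext fg.
case: _ / fg in gA gZ *.
by rewrite (Prop_irrelevance fA gA) (Prop_irrelevance fZ gZ).
Qed.

Definition hom (S : pzRingType) (U V : lmodType S) : Type := {linear U -> V}.
Identity Coercion linear_of_hom : hom >-> GRing.Linear.type.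

Section HomZmodule.
Variables (S : pzRingType) (U V : lmodType S).
Implicit Types f g : hom U V.

HB.instance Definition _ := gen_eqMixin (hom U V).
HB.instance Definition _ := gen_choiceMixin (hom U V).

Definition hom_zero : hom U V := (\0 : {linear U -> V}).
Definition hom_opp f : hom U V := (\- f : {linear U -> V}).
Definition hom_add f g : hom U V := (f \+ g : {linear U -> V}).

Lemma hom_addA : associative hom_add.
Proof. by move=> f g h; apply: linear_ext => x /=; rewrite addrA. Qed.

Lemma hom_addC : commutative hom_add.
Proof. by move=> f g; apply: linear_ext => x /=; rewrite addrC. Qed.

Lemma hom_add0 : left_id hom_zero hom_add.
Proof. by move=> f; apply: linear_ext => x /=; rewrite add0r. Qed.

Lemma hom_addN : left_inverse hom_zero hom_opp hom_add.
Proof. by move=> f; apply: linear_ext => x /=; rewrite addNr. Qed.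

HB.instance Definition _ :=
  GRing.isZmodule.Build (hom U V) hom_addA hom_addC hom_add0 hom_addN.

End HomZmodule.

(* The dual Hom(A, R) of a right module A: a left module by (r.f)(a) = r f(a). *)
Section RightDual.
Variables (R : pzRingType) (A : lmodType R^c).

Definition rdual : Type := hom A R^c^o.
HB.instance Definition _ := GRing.Zmodule.on rdual.
Identity Coercion hom_of_rdual : rdual >-> hom.
Implicit Types (r : R) (f : rdual).

Definition rdual_scale_fun r f (a : A) : R^c^o := r * (f a : R).

Lemma rdual_scale_is_linear r f : linear (rdual_scale_fun r f).
Proof.
move=> k a b; rewrite /rdual_scale_fun linearD linearZ mulrDr.
by congr (_ + _); exact: (@mulrA R r (f a) k).
Qed.

HB.instance Definition _ r f := GRing.isLinear.Build _ _ _ _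
  (rdual_scale_fun r f) (rdual_scale_is_linear r f).

Definition rdual_scale r f : rdual :=
  (rdual_scale_fun r f : {linear A -> R^c^o}).

Lemma rdual_scaleA r s f :
  rdual_scale r (rdual_scale s f) = rdual_scale (r * s) f.
Proof. by apply: linear_ext => a; exact: (@mulrA R r s (f a)). Qed.

Lemma rdual_scale1 : left_id 1 rdual_scale.
Proof. by move=> f; apply: linear_ext => a; exact: (@mul1r R (f a)). Qed.

Lemma rdual_scaleDr : right_distributive rdual_scale +%R.
Proof. by move=> r f g; apply: linear_ext => a; exact: (@mulrDr R r (f a) (g a)). Qed.

Lemma rdual_scaleDl f : {morph rdual_scale^~ f : r s / r + s}.
Proof. by move=> r s; apply: linear_ext => a; exact: (@mulrDl R r s (f a)). Qed.

HB.instance Definition _ := GRing.Zmodule_isLmodule.Build R rdual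
  rdual_scaleA rdual_scale1 rdual_scaleDr rdual_scaleDl.

End RightDual.

(* The dual Hom(M, R) of a left module M: a right module by
   (f.r)(m) = f(m) r. *)
Section LeftDual.
Variables (R : pzRingType) (M : lmodType R).

Definition ldual : Type := hom M R^o.
HB.instance Definition _ := GRing.Zmodule.on ldual.
Identity Coercion hom_of_ldual : ldual >-> hom.
Implicit Types (r : R^c) (f : ldual).

Definition ldual_scale_fun r f (m : M) : R^o := (f m : R) * (r : R).

Lemma ldual_scale_is_linear r f : linear (ldual_scale_fun r f).
Proof.
move=> k a b; rewrite /ldual_scale_fun linearD linearZ mulrDl.
by congr (_ + _); exact: (esym (@mulrA R k (f a) r)).
Qed.

HB.instance Definition _ r f := GRing.isLinear.Build _ _ _ _
  (ldual_scale_fun r f) (ldual_scale_is_linear r f).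

Definition ldual_scale r f : ldual :=
  (ldual_scale_fun r f : {linear M -> R^o}).

Lemma ldual_scaleA r s f :
  ldual_scale r (ldual_scale s f) = ldual_scale (r * s) f.
Proof. by apply: linear_ext => a; exact: (esym (@mulrA R (f a) s r)). Qed.

Lemma ldual_scale1 : left_id 1 ldual_scale.
Proof. by move=> f; apply: linear_ext => a; exact: (@mulr1 R (f a)). Qed.

Lemma ldual_scaleDr : right_distributive ldual_scale +%R.
Proof. by move=> r f g; apply: linear_ext => a; exact: (@mulrDl R (f a) (g a) r). Qed.

Lemma ldual_scaleDl f : {morph ldual_scale^~ f : r s / r + s}.
Proof. by move=> r s; apply: linear_ext => a; exact: (@mulrDr R (f a) r s). Qed.

HB.instance Definition _ := GRing.Zmodule_isLmodule.Build R^c ldual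
  ldual_scaleA ldual_scale1 ldual_scaleDr ldual_scaleDl.

End LeftDual.

(* The canonical map A -> A^**, a |-> (f |-> f(a)). *)
Section Evaluation.
Variables (R : pzRingType) (A : lmodType R^c).

Definition eval_at (a : A) (f : rdual A) : R^o := f a.

Lemma eval_at_is_linear a : linear (eval_at a).
Proof. by []. Qed.

HB.instance Definition _ a := GRing.isLinear.Build _ _ _ _
  (eval_at a) (eval_at_is_linear a).

Definition bidual_map (a : A) : ldual (rdual A) :=
  (eval_at a : {linear rdual A -> R^o}).

Lemma bidual_map_is_linear : linear bidual_map.
Proof.
by move=> r a b; apply: linear_ext => f; rewrite /= /eval_at linearD linearZ.
Qed.

HB.instance Definition _ := GRing.isLinear.Build _ _ _ _
  bidual_map bidual_map_is_linear.

Definition bass_torsion : {pred A} := [pred a | bidual_map a == 0].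

Lemma bass_torsion_submod : submod_closed bass_torsion.
Proof.
split=> [|r a b]; rewrite !inE ?linear0 // => /eqP a0 /eqP b0.
by rewrite linearD linearZ /= a0 b0 scaler0 addr0.
Qed.

End Evaluation.
Arguments bass_torsion {R} A _.

Lemma bass_torsion_functor (R : pzRingType) (A B : lmodType R^c)
    (g : {linear A -> B}) a :
  a \in bass_torsion A -> g a \in bass_torsion B.
Proof.
rewrite !inE => /eqP a0; apply/eqP; apply: linear_ext => f.
have /(congr1 (fun h : ldual (rdual A) => h (f \o g : {linear _ -> _}))) := a0.
by [].
Qed.

(* Main.v *)
(* A right-linear form f : A -> R induces A (x) I -> R (x) I = I, a (x) m |-> f(a) m.
   If a (x) iota(1) = 0 then iota(f(a)) = f(a) iota(1) = 0, and f(a) = 0 because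
   iota is injective. *)

Require Import Defs.
From HB Require Import structures.
From mathcomp Require Import all_boot all_order all_algebra.

Set Implicit Arguments.
Unset Strict Implicit.
Unset Printing Implicit Defensive.

Import GRing.Theory.
Local Open Scope ring_scope.

(** An element is Bass torsion when every form [f] kills it. Right linearity,
    [f(a.r) m = f(a) (r m)], makes the action below balanced, so [f] extends to [A (x) I] and
    carries the vanishing of [a (x) iota(1)] into [I]. *)

Lemma rdual_act_balanced (R : pzRingType) (A : lmodType R^c) (M : lmodType R)
    (f : rdual A) : balanced (fun (a : A) (m : M) => (f a : R) *: m).
Proof.
split=> [x y m|x m n|x r m]; first by rewrite linearD scalerDl.
- by rewrite scalerDr.
- by rewrite linearZ scalerA.
Qed.

Theorem proposition2p10 (R : pzRingType) (I : lmodType R)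
    (iota : {linear R^o -> I}) (iota_env : injective_envelope iota)
    (A : lmodType R^c) :
  {subset inj_torsion iota A <= bass_torsion A}.
Proof.
have [_ [iota_inj _]] := iota_env.
move=> a /inj_torsionP a0; rewrite inE; apply/eqP/linear_ext => f.
(* Of the envelope, injectivity of [iota] is what lets [f a = 0] be tested in [I]. *)
apply: iota_inj; rewrite [RHS]linear0.
have := tensor_liftE (rdual_act_balanced I f) a (iota 1).
(* Left linearity of [iota] gives [f(a) iota(1) = iota(f(a) 1)]. *)
by rewrite a0 raddf0 -linearZ -[_ *: _]/((f a : R) * 1) mulr1 => <-.
Qed.
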